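(* Let $$U=1+\sum_{m\ge1}(-1)^m\,\mathbf{G}_{\tau_{2m}}-\sum_{m\ge0}(-1)^m\,\mathbf{G}_{\rho_{2m+1}} =1-\big[\mathbf G_1+\mathbf G_{1\bar2}-\mathbf G_{12\bar3}-\mathbf G_{1\bar23\bar4}+\mathbf G_{12\bar34\bar5}+\mathbf G_{1\bar23\bar45\bar6}+\cdots\big],$$ where $\tau_{2m}$ is the signed permutation of size $2m$ with $|\tau_{2m}|$ the identity and $\tau_{2m}(i)<0$ iff $i$ is even, and $\rho_{2m+1}$ is the signed permutation of size $2m+1$ with $|\rho_{2m+1}|$ the identity and $\rho_{2m+1}(i)<0$ iff $i$ is odd and $i\ge3$. Then $\phi(U)=\cos z-\sin z$, and $$U^{-1}=\sum_{n\ge0}\sum_{\pi\in\mathcal V_n}\mathbf{G}_\pi .$$ Consequently, for every $n\ge0$, $\#\mathcal V_n$ equals the number of type $B$ snakes of size $n$, i.e. the number of signed permutations $\pi$ of size $n$ with $0<\pi_1>\pi_2<\pi_3>\pi_4<\cdots$.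
   Context: A signed permutation of size $n$ is a word $\pi=\pi_1\cdots\pi_n$ over the integers such that $|\pi_1|,\dots,|\pi_n|$ is a permutation of $\{1,\dots,n\}$ (written $(\sigma,\epsilon)$, $\pi_i=\epsilon_i\sigma(i)$); a negative letter $-k$ is written $\bar k$, and letters are compared as integers. For a word $w$ of distinct integers, $\mathrm{std}(w)$ is the permutation with the same relative order. ${\bf FQSym}^{(2)}$ is the algebra with basis $\mathbf G_{(\sigma,\epsilon)}$ indexed by signed permutations of all sizes (unit $\mathbf G_\emptyset=1$), with product $\mathbf{G}_{(\alpha,\epsilon)}\mathbf{G}_{(\beta,\eta)}=\sum_{\gamma}\mathbf{G}_{(\gamma,\epsilon\cdot\eta)}$, the sum over $\gamma\in\mathfrak S_{k+l}$ with $\mathrm{std}(\gamma_1\cdots\gamma_k)=\alpha$, $\mathrm{std}(\gamma_{k+1}\cdots\gamma_{k+l})=\beta$ ($k,l$ the sizes), $\epsilon\cdot\eta$ the concatenation; formal infinite sums are allowed. The map $\phi$ sending $\mathbf G_\pi$ with $\pi$ of size $n$ to $z^n/n!$ (extended linearly to formal sums) is an algebra homomorphism to $\mathbb C[[z]]$. A signed permutation $\pi$ of size $n$ is valley-signed if for every $i\in\{1,\dots,n\}$, $\pi_i<0$ implies that either ($i>2$, $\pi_{i-1}>0$, and $|\pi_{i-2}|>\pi_{i-1}<|\pi_i|$) or ($i=2$ and $0<\pi_1<|\pi_2|$). $\mathcal V_n$ denotes the set of valley-signed permutations of size $n$. *)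

(* Defs.v *)
From mathcomp Require Import all_boot all_order all_algebra all_fingroup.

Set Implicit Arguments.
Unset Strict Implicit.
Unset Printing Implicit Defensive.

Import Order.TTheory GRing.Theory Num.Theory.
Local Open Scope ring_scope.

(* A signed permutation is kept as a pair (sigma, epsilon), where
   [true] stands for a negative sign; positions and values of 'S_n start
   at 0, whereas those of the word [word pi] below start at 1. *)
Definition sperm (n : nat) : Type := ('S_n * {ffun 'I_n -> bool})%type.

Definition word n (pi : sperm n) : seq int :=
  [seq (-1) ^+ pi.2 i * (pi.1 i).+1%:Z | i <- enum 'I_n].

(* [letter pi i] is pi_i for 1 <= i <= n. *)
Definition letter n (pi : sperm n) (i : nat) : int := nth 0 (word pi) i.-1.

(* Signed permutations of all sizes; [tag q] is the size of q. *)
Definition sperms : Type := {n : nat & sperm n}.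

(* std(w) = alpha, for a word w of distinct letters. *)
Definition std_is k (w : 'I_k -> nat) (alpha : 'S_k) : bool :=
  [forall i, forall j, (alpha i < alpha j)%N == (w i < w j)%N].

Definition sign_cat k l (eps : {ffun 'I_k -> bool}) (eta : {ffun 'I_l -> bool})
    : {ffun 'I_(k + l) -> bool} :=
  [ffun i => match split i with inl a => eps a | inr b => eta b end].

(* A formal, possibly infinite, linear combination of the G_pi is the
   function giving the coefficient of each G_pi. *)
Definition FQSym2 (K : fieldType) : Type := sperms -> K.

Section FQSym2.
Variable K : fieldType.
Implicit Types F H : FQSym2 K.

Definition G (p : sperms) : FQSym2 K := fun q => (q == p)%:R.

Definition Gmul k l (a : sperm k) (b : sperm l) : FQSym2 K := fun q =>
  \sum_(gamma : 'S_(k + l) |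
          std_is (fun i : 'I_k => gamma (lshift l i) : nat) a.1
          && std_is (fun j : 'I_l => gamma (rshift k j) : nat) b.1)
     G (Tagged sperm ((gamma, sign_cat a.2 b.2) : sperm (k + l))) q.

(* The bilinear extension of [Gmul]. As [Gmul a b] is homogeneous of degree
   k + l, only sizes k, l <= tag q can contribute to the coefficient at q. *)
Definition mul F H : FQSym2 K := fun q =>
  \sum_(k < (tag q).+1) \sum_(l < (tag q).+1)
    \sum_(a : sperm k) \sum_(b : sperm l)
      F (Tagged sperm a) * H (Tagged sperm b) * Gmul a b q.

Definition empty_sperm : sperm 0 := (1%g, [ffun=> false]).

Definition one : FQSym2 K := G (Tagged sperm empty_sperm).

Definition is_inverse F H : Prop := mul F H =1 one /\ mul H F =1 one.

(* The formal sum of the F m for m >= a, for families in which F m only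
   involves sizes >= m: the terms m > tag q vanish at q. *)
Definition fsum (a : nat) (F : nat -> FQSym2 K) : FQSym2 K := fun q =>
  \sum_(a <= m < (tag q).+1) F m q.

(* Formal power series in z, as sequences of coefficients. *)
Definition phi F : nat -> K := fun n =>
  \sum_(pi : sperm n) F (Tagged sperm pi) / n`!%:R.

Definition cos_series : nat -> K := fun n =>
  if odd n then 0 else (-1) ^+ n./2 / n`!%:R.

Definition sin_series : nat -> K := fun n =>
  if odd n then (-1) ^+ n./2 / n`!%:R else 0.

(* The signed permutation with underlying identity whose i-th letter
   (counted from 1) is negative iff [neg i]. *)
Definition signed_id (n : nat) (neg : pred nat) : sperm n :=
  (1%g, [ffun i : 'I_n => neg i.+1]).

Definition tau (m : nat) : sperms :=
  Tagged sperm (signed_id (2 * m)%N (fun i => ~~ odd i)).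

Definition rho (m : nat) : sperms :=
  Tagged sperm (signed_id (2 * m + 1)%N (fun i => odd i && (3 <= i)%N)).

Definition U : FQSym2 K := fun q =>
  one q + fsum 1 (fun m p => (-1) ^+ m * G (tau m) p) q
        - fsum 0 (fun m p => (-1) ^+ m * G (rho m) p) q.

End FQSym2.

Definition valley_signed n (pi : sperm n) : bool :=
  all (fun i : nat =>
         (letter pi i < 0) ==>
           ([&& (2 < i)%N, 0 < letter pi (i - 1)%N,
                letter pi (i - 1)%N < `|letter pi (i - 2)%N|
              & letter pi (i - 1)%N < `|letter pi i| ]
            || [&& (i == 2)%N, 0 < letter pi 1 & letter pi 1 < `|letter pi 2| ]))
      (iota 1 n).

Definition V (n : nat) : {set sperm n} := [set pi | valley_signed pi].

Definition V_sum (K : fieldType) : FQSym2 K :=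
  fsum 0 (fun n q => \sum_(pi in V n) G K (Tagged sperm pi) q).

(* 0 < pi_1 > pi_2 < pi_3 > ... ; the empty signed permutation is a snake. *)
Definition snakeB n (pi : sperm n) : bool :=
  ((0 < n)%N ==> (0 < letter pi 1))
  && all (fun i : nat => if odd i then letter pi i.+1 < letter pi i
                         else letter pi i < letter pi i.+1)
         (iota 1 n.-1).

(* Main.v *)
(* Whether a signed permutation occurs in U, and whether it is valley-signed,
   only depends on its signs and on the relative order of its absolute values.
   For such formal sums, the coefficient of a product at pi is the sum, over all
   factorisations of the word pi into a prefix and a suffix, of the products of
   the two coefficients. So U * V = 1 and V * U = 1 say that certain alternating
   sums over the factorisations of a fixed nonempty word vanish; both telescope.
   The snake count does not go through generating functions. Multiplying the even
   positions of a snake by -1 turns the snake condition into: the first letter is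
   positive and, of two adjacent letters, the one with larger absolute value is
   positive, i.e. negative letters only occur at valleys. Reversing the absolute
   values and moving each sign from its valley to the following position yields
   exactly the valley-signed permutations. *)
Require Import Defs.
From mathcomp Require Import all_boot all_order all_algebra all_fingroup.
From mathcomp Require Import reals complex.
From mathcomp Require Import zify.

Set Implicit Arguments.
Unset Strict Implicit.
Unset Printing Implicit Defensive.

Import Order.TTheory GRing.Theory Num.Theory.
Local Open Scope ring_scope.

(** * Standardization and the product of formal sums *)

(** Pulled back along the bijection [alpha], the values below [alpha i] become the positions of
    letters below [w i]; so [w] determines [alpha]. *)
Lemma std_is_rank k (w : 'I_k -> nat) (alpha : 'S_k) (i : 'I_k) :
  std_is w alpha -> alpha i = #|[set j | (w j < w i)%N]| :> nat.
Proof.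
move=> /forallP std.
have -> : [set j | (w j < w i)%N] = alpha @^-1: [set j : 'I_k | (j < alpha i)%N].
  by apply/setP=> j; rewrite !inE; have /forallP/(_ i)/eqP := std j.
rewrite card_preimset; last exact: perm_inj.
rewrite cardsE -sum1_card -(big_ord_widen _ (fun=> 1%N)) ?sum1_card ?card_ord //.
exact/ltnW/ltn_ord.
Qed.

Lemma std_is_uniq k (w : 'I_k -> nat) (alpha beta : 'S_k) :
  std_is w alpha -> std_is w beta -> alpha = beta.
Proof.
move=> ha hb; apply/permP=> i; apply/val_inj.
by rewrite /= (std_is_rank i ha) (std_is_rank i hb).
Qed.

Lemma std_is_exists k (w : 'I_k -> nat) :
  injective w -> exists alpha : 'S_k, std_is w alpha.
Proof.
move=> w_inj; pose r i := #|[set j | (w j < w i)%N]|.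
have r_lt i : (r i < k)%N.
  rewrite -[X in (_ < X)%N]card_ord -cardsT; apply: proper_card.
  by rewrite properT; apply/eqP=> /setP/(_ i); rewrite !inE ltnn.
have r_mono i j : (w i < w j)%N -> (r i < r j)%N.
  move=> lt_ij; apply: proper_card; apply/properP; split.
    by apply/subsetP=> a; rewrite !inE => /ltn_trans; apply.
  by exists i; rewrite !inE ?ltnn.
have r_inj : injective (fun i => Ordinal (r_lt i)).
  move=> i j [eq_r]; apply: w_inj.
  by case: (ltngtP (w i) (w j)) => // /r_mono; rewrite eq_r ltnn.
exists (perm r_inj); apply/forallP=> i; apply/forallP=> j; rewrite !permE /=.
case: (ltngtP (w i) (w j)) => [/r_mono -> // | /r_mono/ltnW | /w_inj ->].
  by rewrite leqNgt => /negbTE ->.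
by rewrite ltnn.
Qed.

(* Positions are counted from 0; [abs_at] and [neg_at] default to 0 and
   [false] beyond the size. *)
Definition abs_at n (pi : sperm n) (i : nat) : nat :=
  oapp (fun j => pi.1 j : nat) 0 (insub i : option 'I_n).

Definition neg_at n (pi : sperm n) (i : nat) : bool :=
  oapp pi.2 false (insub i : option 'I_n).

Lemma abs_atE n (pi : sperm n) (i : 'I_n) : abs_at pi i = pi.1 i.
Proof. by rewrite /abs_at valK. Qed.

Lemma neg_atE n (pi : sperm n) (i : 'I_n) : neg_at pi i = pi.2 i.
Proof. by rewrite /neg_at valK. Qed.

Lemma abs_at_inj n (pi : sperm n) : {in gtn n &, injective (abs_at pi)}.
Proof.
move=> i j; rewrite !unfold_in /= => lti ltj.
rewrite (abs_atE pi (Ordinal lti)) (abs_atE pi (Ordinal ltj)).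
by move=> /val_inj/perm_inj [].
Qed.

Definition shift T k (x : nat -> T) (i : nat) : T := x (k + i)%N.

(** Such coefficient functions agree on a factor of a word and on its standardization, so prefixes
    and suffixes can be used as they stand. *)
Definition std_invariant T (f : nat -> (nat -> nat) -> (nat -> bool) -> T) :=
  forall n x y d e,
    (forall i j, (i < n)%N -> (j < n)%N -> (x i < x j)%N = (y i < y j)%N) ->
    (forall i, (i < n)%N -> d i = e i) -> f n x d = f n y e.

Section Product.
Variable K : fieldType.
Variables (F H : FQSym2 K) (f h : nat -> (nat -> nat) -> (nat -> bool) -> K).
Hypotheses (f_inv : std_invariant f) (h_inv : std_invariant h).
Hypothesis F_f :
  forall n (pi : sperm n), F (Tagged sperm pi) = f n (abs_at pi) (neg_at pi).
Hypothesis H_h :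
  forall n (pi : sperm n), H (Tagged sperm pi) = h n (abs_at pi) (neg_at pi).

Lemma Gmul_coef k l (a : sperm k) (b : sperm l) (pi : sperm (k + l)) :
  Gmul K a b (Tagged sperm pi) =
  [&& std_is (fun i => pi.1 (lshift l i) : nat) a.1,
      std_is (fun j => pi.1 (rshift k j) : nat) b.1
    & pi.2 == sign_cat a.2 b.2]%:R.
Proof.
case: pi => g e /=; rewrite /Gmul big_mkcond (bigD1 g) //= big1 ?addr0 => [|g' ne].
  rewrite andbA /G eq_Tagged xpair_eqE eqxx /=; by case: (_ && _).
by case: ifP => // _; rewrite /G eq_Tagged xpair_eqE eq_sym (negbTE ne).
Qed.

Lemma Gmul_coef_neq k l n (a : sperm k) (b : sperm l) (pi : sperm n) :
  (k + l)%N != n -> Gmul K a b (Tagged sperm pi) = 0.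
Proof.
move=> ne; rewrite /Gmul big1 // => g _; rewrite /G.
by case: eqP => // /(congr1 (@tag _ _)) /= eq_n; rewrite eq_n eqxx in ne.
Qed.

Lemma sign_cat_eq k l (e : {ffun 'I_(k + l) -> bool}) eps eta :
  (e == sign_cat eps eta) =
  (eps == [ffun i => e (lshift l i)]) && (eta == [ffun j => e (rshift k j)]).
Proof.
apply/eqP/andP=> [->|[/eqP-> /eqP->]].
  split; apply/eqP/ffunP=> i; rewrite !ffunE ?(unsplitK (inl _)) ?(unsplitK (inr _)) //.
apply/ffunP=> i; rewrite ffunE; case: split_ordP => j ->; by rewrite ffunE.
Qed.

(** Exactly one pair contributes: the standardizations of the prefix and of the suffix of [pi], each
    with its own signs. *)
Lemma Gmul_sum k l (pi : sperm (k + l)) :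
  \sum_(a : sperm k) \sum_(b : sperm l)
     F (Tagged sperm a) * H (Tagged sperm b) * Gmul K a b (Tagged sperm pi) =
  f k (abs_at pi) (neg_at pi) * h l (shift k (abs_at pi)) (shift k (neg_at pi)).
Proof.
have [|al al_std] := @std_is_exists k (fun i => pi.1 (lshift l i)).
  by move=> i j /val_inj/perm_inj/lshift_inj.
have [|be be_std] := @std_is_exists l (fun j => pi.1 (rshift k j)).
  by move=> i j /val_inj/perm_inj/rshift_inj.
pose a0 : sperm k := (al, [ffun i => pi.2 (lshift l i)]).
pose b0 : sperm l := (be, [ffun j => pi.2 (rshift k j)]).
have coefE a b : Gmul K a b (Tagged sperm pi) = ((a == a0) && (b == b0))%:R.
  rewrite Gmul_coef sign_cat_eq; case: a b => [al' e] [be' e'] /=.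
  rewrite /a0 /b0 !xpair_eqE; congr (_%:R); congr nat_of_bool.
  have -> : std_is (fun i => pi.1 (lshift l i) : nat) al' = (al' == al).
    by apply/idP/eqP=> [/std_is_uniq/(_ al_std)|->].
  have -> : std_is (fun j => pi.1 (rshift k j) : nat) be' = (be' == be).
    by apply/idP/eqP=> [/std_is_uniq/(_ be_std)|->].
  by rewrite -!andbA; congr (_ && _); rewrite andbCA.
rewrite (bigD1 a0) //= [X in _ + X]big1 => [|a ne]; last first.
  by rewrite big1 // => b _; rewrite coefE (negbTE ne) mulr0.
rewrite (bigD1 b0) //= big1 => [|b ne]; last first.
  by rewrite coefE (negbTE ne) andbF mulr0.
rewrite coefE !eqxx mulr1 !addr0 F_f H_h; congr (_ * _).
  apply: f_inv => [i j lti ltj | i lti].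
    rewrite (abs_atE a0 (Ordinal lti)) (abs_atE a0 (Ordinal ltj)) /=.
    move/forallP/(_ (Ordinal lti))/forallP/(_ (Ordinal ltj))/eqP: al_std => ->.
    by rewrite -!abs_atE.
  by rewrite (neg_atE a0 (Ordinal lti)) ffunE -neg_atE.
apply: h_inv => [i j lti ltj | i lti].
  rewrite (abs_atE b0 (Ordinal lti)) (abs_atE b0 (Ordinal ltj)) /=.
  move/forallP/(_ (Ordinal lti))/forallP/(_ (Ordinal ltj))/eqP: be_std => ->.
  by rewrite -!abs_atE.
by rewrite (neg_atE b0 (Ordinal lti)) ffunE -neg_atE.
Qed.

Lemma mul_coef n (pi : sperm n) :
  Defs.mul F H (Tagged sperm pi) =
  \sum_(k < n.+1) f k (abs_at pi) (neg_at pi) *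
                  h (n - k) (shift k (abs_at pi)) (shift k (neg_at pi)).
Proof.
rewrite /Defs.mul /=; apply: eq_bigr => -[k /= ltk] _.
(* By degree, only [l = n - k] contributes. *)
have ltl : (n - k < n.+1)%N by rewrite ltnS leq_subr.
rewrite (bigD1 (Ordinal ltl)) //= [X in _ + X]big1 => [|l ne]; last first.
  rewrite big1 // => a _; rewrite big1 // => b _.
  rewrite Gmul_coef_neq ?mulr0 //; apply: contra_neq ne => eq_n.
  by apply: val_inj => /=; lia.
rewrite addr0; have eq_n : (k + (n - k))%N = n by rewrite subnKC.
move: (n - k)%N eq_n {ltl ltk} => l eq_n; case: n / eq_n pi => pi.
exact: Gmul_sum.
Qed.

End Product.

(** * The alternating sums over factorisations *)

(* Reading backwards, the signs alternate from a negative last letter, except that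
   position 0 is always positive: this covers both tau (n even) and rho (n odd). *)
Definition U_neg (n i : nat) : bool := (0 < i)%N && (odd i (+) odd n).

Definition U_word (n : nat) (x : nat -> nat) (e : nat -> bool) : bool :=
  all (fun i => x i < x i.+1)%N (iota 0 n.-1)
  && all (fun i => e i == U_neg n i) (iota 0 n).

(** For [i = 1] no letter precedes the valley and [i.-2] truncates to 0, hence the separate
    disjunct. *)
Definition valley_at (x : nat -> nat) (e : nat -> bool) (i : nat) : bool :=
  e i ==> [&& (0 < i)%N, ~~ e i.-1, (x i.-1 < x i)%N
            & (i == 1)%N || (x i.-1 < x i.-2)%N].

Definition valley_word (n : nat) (x : nat -> nat) (e : nat -> bool) : bool :=
  all (valley_at x e) (iota 0 n).

Lemma U_word_inv : std_invariant U_word.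
Proof.
move=> n x y d e eq_xy eq_de; congr (_ && _); apply: eq_in_all => i.
  by rewrite mem_iota => lti; apply: eq_xy; lia.
by rewrite mem_iota => lti; rewrite eq_de.
Qed.

Lemma valley_word_inv : std_invariant valley_word.
Proof.
move=> n x y d e eq_xy eq_de; apply: eq_in_all => i; rewrite mem_iota => lti.
by rewrite /valley_at !eq_de ?eq_xy //; lia.
Qed.

Lemma all_iotaD (p : pred nat) m k n :
  all p (iota (m + k) n) = all (fun i => p (m + i)%N) (iota k n).
Proof. by rewrite iotaDl all_map. Qed.

(* The terms of the telescoping sum for U * V: the prefix of length k occurs in U,
   the next letter is positive, and the valley condition holds in the whole word
   from position k + 1 on. *)
Definition U_prefix (n k : nat) (x : nat -> nat) (e : nat -> bool) : bool :=
  [&& (k <= n)%N, U_word k x e, (k < n)%N ==> ~~ e k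
    & all (valley_at x e) (iota k.+1 (n - k.+1))].

Lemma all_iotaS (p : pred nat) n :
  all p (iota 0 n.+1) = all p (iota 0 n) && p n.
Proof. by rewrite -addn1 iotaD all_cat all_seq1. Qed.

(** Two more letters keep the parity of the length, hence the earlier signs. The shorter word is
    nonempty so that its last letter can be compared. *)
Lemma U_wordSS k x e :
  U_word k.+3 x e = [&& U_word k.+1 x e, (x k < x k.+1)%N, (x k.+1 < x k.+2)%N,
    ~~ e k.+1 & e k.+2].
Proof.
rewrite /U_word [k.+3.-1]/= [k.+1.-1]/= !all_iotaS.
have -> : U_neg k.+3 k.+1 = false by rewrite /U_neg /=; lia.
have -> : U_neg k.+3 k.+2 = true by rewrite /U_neg /=; lia.
have eq_neg i : U_neg k.+3 i = U_neg k.+1 i by rewrite /U_neg /= negbK.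
have -> : all (fun i => e i == U_neg k.+3 i) (iota 0 k)
        = all (fun i => e i == U_neg k.+1 i) (iota 0 k).
  by apply: eq_all => i; rewrite eq_neg.
rewrite eq_neg eqbF_neg eqb_id.
by case: (all _ (iota 0 k)); case: (all _ _); case: (x k < _)%N; case: (x _ < _)%N;
  case: (e k == _); case: (e _); case: (e _).
Qed.

(** [valley_at] looks back two positions, so from its third letter on the suffix does not see the
    cut. *)
Lemma all_valley_shift k m l x e :
  all (valley_at (shift k x) (shift k e)) (iota m.+2 l)
  = all (valley_at x e) (iota (k + m.+2) l).
Proof.
rewrite all_iotaD; apply: eq_in_all => i; rewrite mem_iota /valley_at /shift => lti.
have -> : ((k + i).-2 = k + i.-2)%N by lia.
have -> : ((k + i).-1 = k + i.-1)%N by lia.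
have -> : (0 < k + i)%N = (0 < i)%N by lia.
by have -> : (k + i == 1)%N = (i == 1)%N by lia.
Qed.

Lemma valley_after_neg x (e : nat -> bool) i d : e i ->
  all (valley_at x e) (iota i.+1 d)
  = ((0 < d)%N ==> ~~ e i.+1) && all (valley_at x e) (iota i.+2 d.-1).
Proof.
by case: d => //= d ei; rewrite {1}/valley_at /= ei implybF.
Qed.

(* The suffix can be valley-signed without the word satisfying the valley condition
   from k on only if position k + 1 is negative and its predecessor exceeds the last
   letter of the prefix: then the prefix of length k + 2 occurs in U. *)
Lemma U_prefix_split n k x e : {in gtn n &, injective x} -> (0 < k <= n)%N ->
  (U_word k x e && valley_word (n - k) (shift k x) (shift k e)
   = U_prefix n k x e + U_prefix n k.+2 x e :> nat)%N.
Proof.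
move=> x_inj; case: k => // k /= le_kn; rewrite /U_prefix le_kn U_wordSS /valley_word.
have -> : (k.+1 < n)%N = (0 < n - k.+1)%N by lia.
have -> : (k.+2 < n)%N = (1 < n - k.+1)%N by lia.
have -> : (k.+3 < n)%N = (2 < n - k.+1)%N by lia.
have -> : (n - k.+2 = (n - k.+1).-1)%N by lia.
have -> : (n - k.+4 = (n - k.+1).-2.-1)%N by lia.
have : (k.+1 + (n - k.+1) <= n)%N by lia.
case: (n - k.+1)%N => [|[|d]] le_d /=; rewrite ?andbT ?addn0 //.
  by rewrite /valley_at /shift /= addn0 implybF.
rewrite all_valley_shift !addn2 !ltnS.
rewrite {1 2 4}/valley_at /shift /= addn0 addn1.
(* Only a negative second letter of the suffix feels the cut: in the whole word it also requires
   [x k.+1 < x k]. If this holds the first term counts, otherwise the second. *)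
have [neg|] := boolP (e k.+2); last first.
  by rewrite /= !(andbF, andbT) addn0.
rewrite valley_after_neg // /= implybF.
have : x k.+1 != x k.
  apply/eqP=> /x_inj eq_k; have : k.+1 = k by apply: eq_k; rewrite unfold_in /=; lia.
  by lia.
case: (U_word _ _ _); rewrite /= ?addn0 //.
case: (e k.+1); rewrite /= ?andbF ?addn0 //.
case: (x k.+1 < x k.+2)%N; rewrite /= ?andbF ?addn0 //.
by case: (ltngtP (x k)) => //= _ _; rewrite ?addn0 ?add0n.
Qed.

(** For the empty prefix, the sign of the second letter, if there is one, tells which term
    counts. *)
Lemma U_prefix0 n x e : (0 < n)%N ->
  (valley_word n x e = U_prefix n 1 x e + U_prefix n 2 x e :> nat)%N.
Proof.
case: n => // n _; rewrite /U_prefix /U_word /valley_word /= !ltnS !subSS !andbT.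
rewrite /U_neg /= !eqbF_neg !eqb_id.
case: n => [|n]; first by rewrite /= /valley_at implybF !andbT addn0.
rewrite /= !subSS subn0 subn1 ltnS {1 2}/valley_at /= implybF.
have [neg|] := boolP (e 1%N); last by rewrite /= !(andbF, andbT) addn0.
rewrite (@valley_after_neg x e 1) //= !andbF add0n andbT; congr nat_of_bool.
by case: (e 0%N); rewrite /= ?andbF ?andbT.
Qed.

Lemma sum_U_valley (K : pzRingType) n x e : {in gtn n &, injective x} -> (0 < n)%N ->
  \sum_(k < n.+1) (-1) ^+ uphalf k * (U_word k x e)%:R *
     (valley_word (n - k) (shift k x) (shift k e))%:R = 0 :> K.
Proof.
(* As [uphalf k.+2 = (uphalf k).+1], the summand at [k > 0] is [g k - g k.+2]; the summand at 0
   cancels the remaining [g 1 + g 2]. *)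
move=> x_inj n_gt0; pose g k : K := (-1) ^+ uphalf k * (U_prefix n k x e)%:R.
have g_big k : (n < k)%N -> g k = 0.
  by rewrite ltnNge /g /U_prefix => /negbTE ->; rewrite mulr0.
have gSS k : (-1) ^+ uphalf k * (U_prefix n k.+2 x e)%:R = - g k.+2.
  by rewrite /g /= exprS mulN1r mulNr opprK.
have tele N : \sum_(k < N) (g k.+1 - g k.+3) = g 1%N + g 2%N - (g N.+1 + g N.+2).
  elim: N => [|N IH]; first by rewrite big_ord0 subrr.
  by rewrite big_ord_recr IH /= -[X in _ + X](addrKA (g N.+2)) subrKA.
rewrite big_ord_recl /= !mul1r subn0.
under eq_bigr => k _.
  rewrite -mulrA -natrM mulnb (U_prefix_split _ x_inj) ?ltn_ord //.
  rewrite add0n natrD mulrDr (gSS k.+1) -/(g k.+1).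
  over.
rewrite (tele n) (g_big n.+1) ?(g_big n.+2) // addr0 subr0.
rewrite (_ : valley_word _ _ _ = valley_word n x e) // (U_prefix0 _ _ n_gt0).
by rewrite natrD /g /= !expr1 !mulN1r -opprD subrr.
Qed.

Definition valley_prefix (k m : nat) (x : nat -> nat) (e : nat -> bool) : bool :=
  valley_word k x e && U_word m.*2 (shift k x) (shift k e).

(* The terms of the telescoping sum for V * U: the even suffix cannot be extended to
   the left by a positive letter to a word occurring in U. For m = 0 it always can,
   unless the word is empty. *)
Definition valley_prefix_desc (k m : nat) (x : nat -> nat) (e : nat -> bool) : bool :=
  valley_prefix k m x e && ((k == 0) || ~~ ((m == 0) || (x k.-1 < x k)))%N.

Lemma all_iota_cons (p : pred nat) n :
  all p (iota 0 n.+1) = p 0 && all (fun i => p i.+1) (iota 0 n).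
Proof. by rewrite /= -(all_iotaD p 1 0). Qed.

(** A letter added in front changes the parity of the positions and of the length together, so the
    other signs stay. *)
Lemma U_word_double_cons k m x e :
  U_word m.*2.+1 (shift k x) (shift k e)
  = [&& ~~ e k, (m == 0)%N || (x k < x k.+1)%N
      & U_word m.*2 (shift k.+1 x) (shift k.+1 e)].
Proof.
have shift0 T (y : nat -> T) : shift k y 0 = y k by rewrite /shift addn0.
rewrite /U_word all_iota_cons shift0 eqbF_neg.
have -> : all (fun i => shift k e i.+1 == U_neg m.*2.+1 i.+1) (iota 0 m.*2)
        = all (fun i => shift k.+1 e i == U_neg m.*2 i) (iota 0 m.*2).
  by apply: eq_all => i; rewrite /shift addnS; congr (_ == _); rewrite /U_neg; lia.
case: m => [|m]; first by rewrite /= !andbT.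
rewrite doubleS [m.*2.+2.+1.-1]/= [m.*2.+2.-1]/= all_iota_cons /shift addn0 addn1.
have -> : all (fun i => x (k + i.+1) < x (k + i.+2))%N (iota 0 m.*2.+1)
        = all (fun i => x (k.+1 + i) < x (k.+1 + i.+1))%N (iota 0 m.*2.+1).
  by apply: eq_all => i; rewrite !addnS.
by rewrite -!andbA; do !bool_congr.
Qed.

Lemma U_word_doubleS k m x e :
  U_word m.+1.*2 (shift k x) (shift k e)
  = [&& ~~ e k, e k.+1, (x k < x k.+1)%N, (m == 0)%N || (x k.+1 < x k.+2)%N
      & U_word m.*2 (shift k.+2 x) (shift k.+2 e)].
Proof.
have shift0 T (y : nat -> T) : shift k y 0 = y k by rewrite /shift addn0.
have shift1 T (y : nat -> T) : shift k y 1 = y k.+1 by rewrite /shift addn1.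
have -> : U_word m.+1.*2 (shift k x) (shift k e)
  = [&& (x k < x k.+1)%N, all (fun i => x (k.+1 + i) < x (k.+1 + i.+1))%N (iota 0 m.*2),
        ~~ e k, e k.+1 & all (fun i => e (k.+2 + i)%N == U_neg m.*2 i) (iota 0 m.*2)].
  rewrite doubleS /U_word [m.*2.+2.-1]/= !all_iota_cons !shift0 !shift1 eqbF_neg.
  have -> : U_neg m.*2.+2 1 = true by rewrite /U_neg /=; lia.
  rewrite eqb_id -!andbA; congr (_ && _); congr (_ && _).
    by apply: eq_all => i; rewrite /shift !addnS.
  do 2!congr (_ && _); apply: eq_all => i; rewrite /shift !addnS; congr (_ == _).
  by rewrite /U_neg; lia.
rewrite /U_word; case: m => [|m]; first by rewrite /= !andbT andbC andbA.
rewrite doubleS [m.*2.+2.-1]/= (all_iota_cons _ m.*2.+1) addn0 addn1.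
have -> : all (fun i => x (k.+1 + i.+1) < x (k.+1 + i.+2))%N (iota 0 m.*2.+1)
        = all (fun i => shift k.+2 x i < shift k.+2 x i.+1)%N (iota 0 m.*2.+1).
  by apply: eq_all => i; rewrite /shift !addnS.
by case: (~~ e k); case: (e k.+1); rewrite ?andbF // -!andbA.
Qed.

(** If the last letter of the prefix is positive, it either extends the suffix to an odd one (second
    term) or does not (first term). If it is negative, it and the valley before it either extend the
    suffix by two letters (third term) or do not (first term). *)
Lemma valley_prefix_split (k m : nat) (x : nat -> nat) e :
    (k == 0)%N || (x k != x k.-1) ->
  (valley_prefix k.+2 m x e = valley_prefix_desc k.+2 m x e
     + (valley_word k.+1 x e && U_word m.*2.+1 (shift k.+1 x) (shift k.+1 e))
     + valley_prefix_desc k m.+1 x e :> nat)%N.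
Proof.
rewrite /valley_prefix_desc /valley_prefix /valley_word !(all_iotaS _ k.+1).
rewrite !(all_iotaS _ k) U_word_double_cons U_word_doubleS.
move=> x_neq; rewrite [valley_at x e k.+1]/valley_at /= eqSS.
have [neg|_] := boolP (e k.+1); last first.
  rewrite !andbF addn0 !andbT.
  by case: (_ && valley_at _ _ _); case: (U_word _ _ _); case: (_ || _).
rewrite implyTb andbF addn0 [valley_at x e k]/valley_at.
have -> : (k == 0)%N || ~~ (x k.-1 < x k)%N = (k == 0)%N || (x k < x k.-1)%N.
  by case: eqP x_neq => //= _; case: ltngtP.
case: (e k); first by rewrite !andbF.
case: (all _ _); case: (x k < x k.+1)%N => //=; case: ((k == 0)%N || _) => //=.
- by case: (U_word _ _ _); case: ((m == 0)%N || _).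
- by rewrite !andbF.
Qed.

Lemma sum_valley_U (K : comPzRingType) n x e : {in gtn n &, injective x} -> (0 < n)%N ->
  \sum_(k < n.+1) (valley_word k x e)%:R *
     ((-1) ^+ uphalf (n - k) * (U_word (n - k) (shift k x) (shift k e))%:R) = 0 :> K.
Proof.
move=> x_inj n_gt0.
(* Indexed by the suffix length, [m.*2] and [m.*2.+1] carry opposite signs; by [b_even] each such
   pair gives [(-1) ^+ m * (d m + d m.+1)], which telescopes. *)
pose b l : K := ((l <= n)%N && valley_word (n - l) x e
  && U_word l (shift (n - l) x) (shift (n - l) e))%:R.
pose d m : K := ((m.*2 <= n)%N && valley_prefix_desc (n - m.*2) m x e)%:R.
have b0 l : (n < l)%N -> b l = 0 by rewrite /b ltnNge => /negbTE ->.
have d0 m : (n < m.*2)%N -> d m = 0 by rewrite /d ltnNge => /negbTE ->.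
have d_0 : d 0%N = 0 by rewrite /d /valley_prefix_desc subn0 eqn0Ngt n_gt0 andbF.
have b_even m : b m.*2 = d m + b m.*2.+1 + d m.+1.
  have [lt_nm|le_mn] := ltnP n m.*2.
    by rewrite !(b0, d0) ?doubleS ?addr0 // !ltnS ltnW ?leqW // ltnW.
  rewrite /b /d le_mn doubleS.
  rewrite (_ : m.*2 < n = (0 < n - m.*2))%N; last by lia.
  rewrite (_ : (m.*2.+1 < n) = (1 < n - m.*2))%N; last by lia.
  rewrite (_ : n - m.*2.+1 = (n - m.*2).-1)%N; last by lia.
  rewrite (_ : n - m.*2.+2 = (n - m.*2).-2)%N; last by lia.
  have : (n - m.*2 <= n)%N by lia.
  case: (n - m.*2)%N => [|[|k]] lt_kn /=; rewrite ?addr0 -?natrD; congr (_%:R).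
  - by rewrite /valley_prefix_desc /= andbT.
  - rewrite U_word_double_cons /valley_prefix_desc /valley_prefix.
    rewrite /valley_word /= /valley_at implybF andbT.
    by case: (~~ e 0%N); case: (U_word _ _ _); case: (_ || _).
  rewrite valley_prefix_split //.
  case: k lt_kn => // k lt_kn; apply/orP; right.
  apply/eqP=> /x_inj eq_k; have : k.+1 = k by apply: eq_k; rewrite unfold_in /=; lia.
  by lia.
have pair_sum N : \sum_(l < N.*2) (-1) ^+ uphalf l * b l = d 0%N - (-1) ^+ N * d N.
  elim: N => [|N IH]; first by rewrite big_ord0 mul1r subrr.
  rewrite doubleS !big_ord_recr IH /= uphalf_double doubleK b_even.
  by rewrite exprS mulN1r !mulNr opprK !mulrDr !addrA subrK addrAC addrK.
pose c k : K := (valley_word k x e)%:R *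
  ((-1) ^+ uphalf (n - k) * (U_word (n - k) (shift k x) (shift k e))%:R).
rewrite -[LHS]/(\sum_(k < n.+1) c k) (reindex_inj rev_ord_inj) /=.
(* Padding with zero terms makes the number of terms even. *)
transitivity (\sum_(l < n.+1.*2) (-1) ^+ uphalf l * b l); last first.
  by rewrite pair_sum d_0 d0 ?mulr0 ?subr0 // -addnn leq_addr.
rewrite (big_ord_widen n.+1.*2 (fun l => c (n.+1 - l.+1)%N)); last first.
  by rewrite -addnn leq_addr.
rewrite [RHS](bigID (fun l : 'I__ => l < n.+1)%N) /=.
rewrite [X in _ = _ + X]big1 ?addr0 => [|l]; last first.
  by rewrite -leqNgt => /b0 ->; rewrite mulr0.
apply: eq_bigr => l; rewrite ltnS subSS => le_ln; rewrite /c subKn // /b le_ln.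
by rewrite mulrCA -natrM mulnb.
Qed.

(** * The coefficients of U and V *)

Lemma U_word_signed_id n (pi : sperm n) (neg : pred nat) :
  (forall i, (i < n)%N -> neg i.+1 = U_neg n i) ->
  U_word n (abs_at pi) (neg_at pi) = (pi == signed_id n neg).
Proof.
case: pi => s e neg_eq; rewrite /U_word /signed_id xpair_eqE /=.
have -> : all (fun i => neg_at (s, e) i == U_neg n i) (iota 0 n)
        = (e == [ffun i : 'I_n => neg i.+1]).
  apply/allP/eqP=> [h|-> i]; last first.
    rewrite mem_iota => /= lti; rewrite (neg_atE _ (Ordinal lti)) /= ffunE /=.
    by rewrite neg_eq.
  apply/ffunP=> i; rewrite ffunE neg_eq // -(eqP (h i _)) ?mem_iota ?ltn_ord //.
  by rewrite neg_atE.
congr (_ && _); apply/allP/eqP=> [h|-> i]; last first.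
  rewrite mem_iota add0n => /= lti.
  have lti1 : (i.+1 < n)%N by lia.
  by rewrite (abs_atE _ (Ordinal lti1)) (abs_atE _ (Ordinal (ltnW lti1))) !perm1.
have mono i j : (i < j)%N -> (j < n)%N -> (abs_at (s, e) i < abs_at (s, e) j)%N.
  elim: j => // j IH; rewrite ltnS leq_eqVlt => /predU1P[->|lt_ij] ltj.
    by apply: h; rewrite mem_iota; lia.
  by apply: (ltn_trans (IH lt_ij (ltnW ltj))); apply: h; rewrite mem_iota; lia.
(* An increasing permutation and the identity both standardize the identity word. *)
apply: (@std_is_uniq n (fun i => i)); apply/forallP=> i; apply/forallP=> j; last first.
  by rewrite !perm1.
have abs_s (a : 'I_n) : s a = abs_at (s, e) a :> nat by rewrite abs_atE.
rewrite !abs_s; case: (ltngtP i j) => [lt_ij|lt_ji|->]; last by rewrite ltnn.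
  by rewrite mono.
by rewrite ltnNge ltnW // mono.
Qed.

Lemma Tagged_sperm_eq n m (pi : sperm n) (neg : pred nat) :
  (Tagged sperm pi == Tagged sperm (signed_id m neg))
  = (n == m) && (pi == signed_id n neg).
Proof.
have [eq_nm|ne] /= := eqVneq n m; first by case: m / eq_nm; rewrite eq_Tagged.
by apply/eqP=> /(congr1 (@tag _ _)) /= eq_nm; rewrite eq_nm eqxx in ne.
Qed.

Lemma eq_empty_sperm (pi : sperm 0) : pi = empty_sperm.
Proof.
case: pi => s e; congr pair; first by apply/permP=> -[].
by apply/ffunP=> -[].
Qed.

Lemma one_coef (K : fieldType) n (pi : sperm n) :
  Defs.one K (Tagged sperm pi) = (n == 0)%N%:R.
Proof.
rewrite /Defs.one /G; case: n pi => [|n] pi; first by rewrite (eq_empty_sperm pi) eqxx.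
by case: eqP => // /(congr1 (@tag _ _)).
Qed.

(** The parity of [n] selects the family: [m = uphalf n] for [tau], [m = n./2] for [rho], where the
    minus sign before the sum accounts for [uphalf n = m.+1]. *)
Lemma U_coef (K : fieldType) n (pi : sperm n) :
  U K (Tagged sperm pi)
  = (-1) ^+ uphalf n * (U_word n (abs_at pi) (neg_at pi))%:R.
Proof.
rewrite /U /fsum /= one_coef.
have sum_tau : \sum_(1 <= m < n.+1) (-1) ^+ m * G K (tau m) (Tagged sperm pi)
  = (~~ odd n && (0 < n)%N)%:R
    * ((-1) ^+ uphalf n * (U_word n (abs_at pi) (neg_at pi))%:R).
  have [/andP[even_n n_gt0]|odd_n] := boolP (~~ odd n && (0 < n)%N); last first.
    rewrite mul0r big_nat_cond big1 // => m /andP[/andP[m_gt0 _] _].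
    rewrite /G /tau Tagged_sperm_eq (_ : (n == 2 * m)%N = false) ?mulr0 //; lia.
  have half : (uphalf n < n.+1)%N && (0 < uphalf n)%N by lia.
  rewrite (bigD1_seq (uphalf n)) ?mem_index_iota ?iota_uniq //=; last by lia.
  rewrite big1 ?addr0 => [|m ne]; last first.
    rewrite /G /tau Tagged_sperm_eq (_ : (n == 2 * m)%N = false) ?mulr0 //; lia.
  rewrite mul1r /G /tau Tagged_sperm_eq (_ : (n == 2 * uphalf n)%N) ?andTb; last by lia.
  by rewrite -U_word_signed_id // => i lti; rewrite /U_neg; lia.
have sum_rho : \sum_(0 <= m < n.+1) (-1) ^+ m * G K (rho m) (Tagged sperm pi)
  = - ((odd n)%:R * ((-1) ^+ uphalf n * (U_word n (abs_at pi) (neg_at pi))%:R)).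
  have [odd_n|even_n] := boolP (odd n); last first.
    rewrite mul0r oppr0 big1 // => m _.
    rewrite /G /rho Tagged_sperm_eq (_ : (n == 2 * m + 1)%N = false) ?mulr0 //; lia.
  have half : (n./2 < n.+1)%N by lia.
  rewrite (bigD1_seq n./2) ?mem_index_iota ?iota_uniq //=.
  rewrite big1 ?addr0 => [|m ne]; last first.
    rewrite /G /rho Tagged_sperm_eq (_ : (n == 2 * m + 1)%N = false) ?mulr0 //; lia.
  rewrite mul1r /G /rho Tagged_sperm_eq (_ : (n == 2 * n./2 + 1)%N) ?andTb; last by lia.
  rewrite (_ : uphalf n = n./2.+1); last by lia.
  rewrite exprS mulN1r mulNr opprK -U_word_signed_id // => i lti.
  by rewrite /U_neg; lia.
rewrite sum_tau sum_rho opprK; case: n pi {sum_tau sum_rho} => [|n] pi.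
  by rewrite /= !mul0r !addr0 mul1r.
by rewrite /= add0r andbT -mulrDl; case: (odd n); rewrite ?addr0 ?add0r mul1r.
Qed.

Lemma letterE n (pi : sperm n) i : (i < n)%N ->
  letter pi i.+1 = (-1) ^+ neg_at pi i * (abs_at pi i).+1%:Z.
Proof.
move=> lti; rewrite /letter /word (nth_map (Ordinal lti)) ?size_enum_ord //.
by rewrite -(neg_atE pi) -(abs_atE pi) nth_enum_ord.
Qed.

Lemma letter_lt0 n (pi : sperm n) i : (i < n)%N -> (letter pi i.+1 < 0) = neg_at pi i.
Proof. by move=> lti; rewrite letterE // mulr_sign; case: (neg_at _ _); lia. Qed.

Lemma letter_gt0 n (pi : sperm n) i : (i < n)%N -> (0 < letter pi i.+1) = ~~ neg_at pi i.
Proof. by move=> lti; rewrite letterE // mulr_sign; case: (neg_at _ _); lia. Qed.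

Lemma abs_letter n (pi : sperm n) i : (i < n)%N ->
  `|letter pi i.+1| = (abs_at pi i).+1%:Z.
Proof. by move=> lti; rewrite letterE // mulr_sign; case: (neg_at _ _); lia. Qed.

Lemma valley_signedE n (pi : sperm n) :
  valley_signed pi = valley_word n (abs_at pi) (neg_at pi).
Proof.
rewrite /valley_signed /valley_word (all_iotaD _ 1 0); apply: eq_in_all => i.
rewrite mem_iota add0n => /andP[_ lti]; rewrite add1n letter_lt0 // /valley_at.
case: (neg_at pi i); rewrite ?implyFb // !implyTb.
case: i lti => [|[|i]] lti; first by [].
  have lt0n := ltnW lti.
  rewrite [(2 < 2)%N]/= [(2 == 2)%N]/= andTb orFb letter_gt0 // abs_letter //.
  rewrite andTb orTb andbT; case: (boolP (neg_at pi 0)) => // pos.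
  by rewrite letterE // (negbTE pos) expr0 mul1r andTb; lia.
have [lt1n lt2n] : (i.+1 < n)%N /\ (i < n)%N by lia.
rewrite subn1 subn2 [(i.+3 == 2)%N]/= andFb orbF letter_gt0 // !abs_letter // letterE //.
case: (boolP (neg_at pi i.+1)) => pos; first by rewrite andbF.
rewrite expr0 !mul1r [i.+2.-1]/= [i.+2.-2]/=.
rewrite !andTb orFb; lia.
Qed.

Lemma V_sum_coef (K : fieldType) n (pi : sperm n) :
  V_sum K (Tagged sperm pi) = (valley_word n (abs_at pi) (neg_at pi))%:R.
Proof.
rewrite /V_sum /fsum /= big_nat_recr //= big_nat_cond big1 ?add0r.
  rewrite -valley_signedE /G.
  have [val|val] := boolP (valley_signed pi).
    rewrite (bigD1 pi) ?inE //= eqxx big1 ?addr0 // => p /andP[_ ne].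
    by rewrite eq_Tagged eq_sym (negbTE ne).
  rewrite big1 // => p; rewrite inE => val_p; rewrite eq_Tagged.
  by case: eqP => //= eq_p; rewrite eq_p val_p in val.
move=> m; rewrite andbT => /= lt_mn; rewrite big1 // => p _; rewrite /G.
by case: eqP => // /(congr1 (@tag _ _)) /= eq_nm; rewrite eq_nm ltnn in lt_mn.
Qed.

Lemma U_V_inverse (K : fieldType) : is_inverse (U K) (V_sum K).
Proof.
have U_inv : std_invariant (fun n x e => (-1) ^+ uphalf n * (U_word n x e)%:R : K).
  by move=> n x y d e eq_xy eq_de; rewrite (U_word_inv eq_xy eq_de).
have V_inv : std_invariant (fun n x e => (valley_word n x e)%:R : K).
  by move=> n x y d e eq_xy eq_de; rewrite (valley_word_inv eq_xy eq_de).
split=> -[n pi]; rewrite -/(Tagged sperm pi).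
  rewrite (mul_coef U_inv V_inv (@U_coef K) (@V_sum_coef K)) one_coef.
  case: n pi => [|n] pi; first by rewrite big_ord1 /= !mul1r.
  by rewrite sum_U_valley //; apply: abs_at_inj.
rewrite (mul_coef V_inv U_inv (@V_sum_coef K) (@U_coef K)) one_coef.
case: n pi => [|n] pi; first by rewrite big_ord1 /= !mul1r.
by rewrite sum_valley_U //; apply: abs_at_inj.
Qed.

Lemma phi_U (K : fieldType) : phi (U K) =1 (fun n => cos_series K n - sin_series K n).
Proof.
move=> n; rewrite /phi.
(* U has a single term in each degree; [signed_id] counts positions from 1, hence [i.-1]. *)
pose p0 := signed_id n (fun i => U_neg n i.-1).
have coefE pi : U K (Tagged sperm pi) = (-1) ^+ uphalf n * (pi == p0)%:R.
  by rewrite U_coef (@U_word_signed_id _ _ (fun i => U_neg n i.-1)).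
rewrite (bigD1 p0) //= big1 ?addr0 => [|pi ne]; last first.
  by rewrite coefE (negbTE ne) mulr0 mul0r.
rewrite coefE eqxx mulr1 /cos_series /sin_series uphalf_half.
by case: (odd n); rewrite /= ?subr0 // exprS mulN1r mulNr sub0r.
Qed.

(** * Snakes *)

Definition alt_neg (e : nat -> bool) (i : nat) : bool := e i (+) odd i.

Definition snake_word (n : nat) (x : nat -> nat) (e : nat -> bool) : bool :=
  ((0 < n)%N ==> ~~ alt_neg e 0)
  && all (fun i => ~~ alt_neg e (if (x i < x i.+1)%N then i.+1 else i)) (iota 0 n.-1).

(** After alternating the signs, both kinds of snake inequality say that two adjacent letters have a
    positive sum, so the one with larger absolute value is positive. *)
Lemma snakeBE n (pi : sperm n) : snakeB pi = snake_word n (abs_at pi) (neg_at pi).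
Proof.
rewrite /snakeB /snake_word; case: n pi => [|n] pi; first by [].
rewrite !implyTb letter_gt0 // /alt_neg addbF; congr (_ && _).
rewrite (all_iotaD _ 1 0); apply: eq_in_all => i.
rewrite mem_iota add0n => /andP[_ lti]; rewrite add1n.
have [lti1 lti2] : (i.+1 < n.+1)%N /\ (i < n.+1)%N by move: lti; lia.
have : abs_at pi i != abs_at pi i.+1.
  apply/eqP=> /(@abs_at_inj _ pi) eq_i; have : i = i.+1 by apply: eq_i; rewrite unfold_in.
  by lia.
rewrite !letterE // !mulr_sign [odd i.+1]/=.
move: (abs_at pi i) (abs_at pi i.+1) => a b.
by case: (ssrnat.ltngtP a b) => //= lt_ab _; case: (neg_at pi i);
  case: (neg_at pi i.+1); case: (odd i) => /=; lia.
Qed.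

Section Reversal.
Variables (n : nat) (x y : nat -> nat) (d e : nat -> bool).
Hypotheses (n_gt0 : (0 < n)%N) (x_inj : {in gtn n &, injective x}).
Hypothesis y_x : forall i, (i < n)%N -> y i = x (n.-1 - i)%N.
Hypothesis d0 : d 0%N = alt_neg e 0.
Hypothesis d_e : forall i, (0 < i < n)%N -> d i = alt_neg e (n - i).

(** The value at [j] moves to [n.-1 - j] and its sign to [n - j], so the valley preceding position
    [n - j] is [x j], flanked by its two former neighbours. *)
Lemma valley_at_rev j : ~~ alt_neg e 0 -> (0 < j < n)%N ->
  valley_at y d (n - j)
  = (alt_neg e j ==> (x j < x j.-1)%N
       && ((j.+1 < n)%N ==> ~~ alt_neg e j.+1 && (x j < x j.+1)%N)).
Proof.
move=> pos0 j_n; have [i n_ij] : exists i, n = (i.+1 + j)%N.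
  by exists (n - j).-1; move: j_n; clear; lia.
have -> : (n - j = i.+1)%N by rewrite n_ij addnK.
have [j_gt0 lt_i1n lt_in] : [/\ 0 < j, i.+1 < n & i < n]%N.
  by move: j_n; rewrite n_ij; clear; split; lia.
rewrite /valley_at [i.+1.-1]/= d_e // (y_x lt_i1n) (y_x lt_in).
have -> : (n - i.+1 = j)%N by rewrite n_ij addKn.
have -> : (n.-1 - i.+1 = j.-1)%N by move: n_ij; clear; lia.
have -> : (n.-1 - i = j)%N by move: n_ij; clear; lia.
rewrite ltn0Sn andTb eqSS; congr (_ ==> _).
(* For [j = n.-1] the valley sits at position 0, which carries the sign of the first letter,
   positive by [pos0]. *)
case: i => [|i] in n_ij lt_i1n lt_in *.
  by rewrite d0 pos0 n_ij add1n ltnn andbT.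
have -> : (j.+1 < n)%N by rewrite n_ij; clear; lia.
rewrite [i.+1.-1]/= d_e // (y_x (ltnW lt_in)).
have -> : (n - i.+1 = j.+1)%N by move: n_ij; clear; lia.
have -> : (n.-1 - i = j.+1)%N by move: n_ij; clear; lia.
by rewrite andbCA.
Qed.

Lemma valley_word_rev : valley_word n y d = snake_word n x e.
Proof.
have x_neq i : (i.+1 < n)%N -> x i != x i.+1.
  move=> lti; apply/eqP=> /x_inj eq_i.
  by have /n_Sn := eq_i (ltnW lti) lti.
rewrite /snake_word n_gt0 implyTb.
(* The valley condition at position 0 supplies the positivity that [valley_at_rev] assumes. *)
have -> : valley_word n y d = ~~ alt_neg e 0 && valley_word n y d.
  case: n n_gt0 => // m _; rewrite /valley_word all_iota_cons.
  have -> : valley_at y d 0 = ~~ alt_neg e 0 by rewrite /valley_at d0 implybF.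
  by rewrite andbA andbb.
have [pos0|] //= := boolP (~~ alt_neg e 0).
apply/allP/allP=> [val|snk] i; rewrite mem_iota add0n => /andP[_ lti].
  have lti1 : (i.+1 < n)%N by move: lti n_gt0; clear; lia.
  have valE j : (0 < j < n)%N -> valley_at y d (n - j).
    by move=> j_n; apply: val; rewrite mem_iota; move: j_n; clear; lia.
  have := x_neq i lti1; rewrite neq_ltn => /orP[lt_x|gt_x].
    rewrite lt_x; have := valE i.+1 lti1; rewrite valley_at_rev //.
    by rewrite ltnNge (ltnW lt_x) implybF.
  rewrite ltnNge (ltnW gt_x) /=; case: i {lti} lti1 gt_x => // i lti1 gt_x.
  have := valE i.+1 (ltnW lti1); rewrite valley_at_rev ?(ltnW lti1) // lti1.
  by rewrite [(x i.+1 < x i.+2)%N]ltnNge (ltnW gt_x) !andbF implybF.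
have [->|i_gt0] := posnP i; first by rewrite /valley_at d0 implybF.
have [j [j_n ->]] : exists j, (0 < j < n)%N /\ i = (n - j)%N.
  by exists (n - i)%N; move: lti i_gt0; clear; split; lia.
rewrite valley_at_rev //; apply/implyP=> neg.
have snkE k : (k.+1 < n)%N -> ~~ alt_neg e (if (x k < x k.+1)%N then k.+1 else k).
  by move=> ltk; apply: snk; rewrite mem_iota; move: ltk; clear; lia.
have [j_gt0 ltj] := andP j_n; apply/andP; split.
  case: j => // j in neg j_gt0 ltj {j_n} *; have := snkE j ltj.
  have := x_neq j ltj; rewrite neq_ltn => /orP[lt_x|//].
  by rewrite lt_x neg.
apply/implyP=> ltj1; have := snkE j ltj1.
by case: ifP => // _; rewrite ?neg // andbT.
Qed.

End Reversal.

(* The unsigned word is reversed, and the alternated sign of the letter at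
   position j > 0 is carried by the position following the image of that
   letter; since indices run over Z/n, this is position - j. *)
Definition rev_sperm n (pi : sperm n.+1) : sperm n.+1 :=
  ((perm rev_ord_inj * pi.1)%g, [ffun i => pi.2 (- i) (+) odd (- i : 'I_n.+1)]).

Lemma rev_sperm_inj n : injective (@rev_sperm n).
Proof.
move=> [s d] [t e] [/mulgI -> /ffunP eq_de]; congr pair; apply/ffunP=> i.
by have := eq_de (- i); rewrite !ffunE opprK => /addIb.
Qed.

Lemma valley_rev_sperm n (pi : sperm n.+1) :
  valley_signed (rev_sperm pi) = snakeB pi.
Proof.
rewrite valley_signedE snakeBE.
have oppE (i : 'I_n.+1) : (- i : 'I_n.+1) = ((n.+1 - i) %% n.+1)%N :> nat by [].
apply: valley_word_rev => // [|i lti| |i /andP[i_gt0 lti]].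
- exact: abs_at_inj.
- by rewrite (abs_atE _ (Ordinal lti)) permM permE -abs_atE /= subSS.
- by rewrite (neg_atE _ ord0) ffunE oppr0 -neg_atE.
- rewrite (neg_atE _ (Ordinal lti)) ffunE -neg_atE oppE /= modn_small //; lia.
Qed.

(** [rev_sperm] is an injective self-map of a finite set, so the preimage of [V] has the size of
    [V]. Size 0 is apart, as [rev_sperm] negates indices in ['I_n.+1]. *)
Lemma card_V_snakeB n : #|V n| = #|[set pi : sperm n | snakeB pi]|.
Proof.
case: n => [|n].
  by congr #|pred_of_set _|; apply/setP=> pi; rewrite !inE valley_signedE snakeBE.
rewrite -[LHS](card_preimset _ (@rev_sperm_inj n)); congr #|pred_of_set _|.
by apply/setP=> pi; rewrite !inE valley_rev_sperm.
Qed.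

Theorem theorem6p2 (R : realType) :
  [/\ phi (U R[i]) =1 (fun n => cos_series R[i] n - sin_series R[i] n),
      is_inverse (U R[i]) (V_sum R[i])
    & forall n : nat, #|V n| = #|[set pi : sperm n | snakeB pi]| ].
Proof. by split; [exact: phi_U | exact: U_V_inverse | exact: card_V_snakeB]. Qed.
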